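(* Let $v_1=(x_1,y_1)$, $v_2=(x_2,y_2)$, $v_3=(x_3,y_3)$ be distinct points of $A_2$. Let $x_{\rm mid}$ denote the middle value among $x_1,x_2,x_3$ (i.e., if $x'_1\le x'_2\le x'_3$ is their nondecreasing rearrangement then $x_{\rm mid}=x'_2$), and define $y_{\rm mid}$ similarly. Then the tristance of $v_1,v_2,v_3$ in the hexagonal graph is $$\sum_{i=1}^3\Bigl(\max\{x_i-x_{\rm mid},\,y_i-y_{\rm mid},\,0\}-\min\{x_i-x_{\rm mid},\,y_i-y_{\rm mid},\,0\}\Bigr).$$
   Context: Let $\omega=-\tfrac12+\tfrac{\sqrt3}{2}i$. The hexagonal lattice is $A_2=\{x+\omega y: x,y\in\mathbb{Z}\}$, and the point $x+\omega y$ is written $(x,y)$. The hexagonal graph has vertex set $A_2$, two points being adjacent iff their Euclidean distance (in $\mathbb{C}$) is $1$; equivalently $(x,y)$ is adjacent to $(x\pm1,y)$, $(x,y\pm1)$, $(x+1,y+1)$, $(x-1,y-1)$. The tristance of three points is the minimum number of edges of a tree in the hexagonal graph (possibly using additional vertices) containing them. *)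

(* Defs.v *)
From mathcomp Require Import all_boot all_order all_algebra.
From mathcomp Require Import finmap reals complex.

Set Implicit Arguments.
Unset Strict Implicit.
Unset Printing Implicit Defensive.

Import Order.TTheory GRing.Theory Num.Theory.
Local Open Scope fset_scope.
Local Open Scope ring_scope.

(* The lattice point x + omega * y is encoded by its coordinates (x, y); the
   encoding is faithful because 1 and omega are linearly independent over the
   reals. *)
Notation hexpoint := (int * int)%type.

Definition omega (R : realType) : R[i] :=
  Complex (- (1 / 2)) (Num.sqrt 3 / 2).

Definition hex_embed (R : realType) (p : hexpoint) : R[i] :=
  p.1%:~R + omega R * p.2%:~R.

(* The norm on R[i] is the complex modulus. *)
Definition hex_adj (R : realType) : rel hexpoint :=
  fun p q => `|hex_embed R p - hex_embed R q| == 1.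

(* A finite simple graph is a pair (V, E) where every edge is a set [fset u; v]
   of two vertices; the relation g below is always irreflexive. *)
Section Trees.
Variable T : choiceType.
Implicit Types (g : rel T) (V : {fset T}) (E : {fset {fset T}}).

Definition is_subgraph g V E : Prop :=
  forall e, e \in E ->
    exists u v, [/\ u \in V, v \in V, g u v & e = [fset u; v]].

Definition edge_rel E : rel T := fun u v => [fset u; v] \in E.

Definition connected_graph V E : Prop :=
  forall u v, u \in V -> v \in V ->
    exists p : seq T, path (edge_rel E) u p /\ last u p = v.

Definition acyclic_graph E : Prop :=
  forall c : seq T, (2 < size c)%N -> uniq c -> ~~ cycle (edge_rel E) c.

Definition is_tree_in g V E : Prop :=
  [/\ V != fset0, is_subgraph g V E, connected_graph V E & acyclic_graph E].

Definition tree_spanning g (s : seq T) V E : Prop :=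
  is_tree_in g V E /\ {subset s <= V}.

End Trees.

(* n is the tristance of p, q and r: the minimum is both attained and a lower
   bound. *)
Definition is_tristance (R : realType) (p q r : hexpoint) (n : nat) : Prop :=
  (exists V E, tree_spanning (hex_adj R) [:: p; q; r] V E /\ #|` E| = n) /\
  (forall V E, tree_spanning (hex_adj R) [:: p; q; r] V E -> (n <= #|` E|)%N).

Definition mid3 (a b c : int) : int := (sort <=%R [:: a; b; c])`_1.

(* Main.v *)
(* Write m = (xmid, ymid) and let d be the graph distance, so that the formula
   is the sum of the d(v_i, m). Geodesics from m to the three points, glued
   together one edge at a time, give a tree with at most that many edges.
   Conversely, any connected graph containing the points contains a tripod:
   edge-disjoint paths from some vertex c to v_1, v_2 and v_3. It thus has at
   least the sum of the d(v_i, c) edges, and that sum is minimal at c = m. *)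

Require Import Defs.
From mathcomp Require Import all_boot all_order all_algebra.
From mathcomp Require Import finmap reals complex.
From mathcomp Require Import zify ring.

Set Implicit Arguments.
Unset Strict Implicit.
Import Order.TTheory GRing.Theory Num.Theory.
Local Open Scope fset_scope.
Local Open Scope ring_scope.

Lemma fset2_inj (T : choiceType) (a b c d : T) :
  [fset a; b] = [fset c; d] -> (a = c /\ b = d) \/ (a = d /\ b = c).
Proof.
move=> E.
have: a \in [fset c; d] by rewrite -E !inE eqxx.
have: b \in [fset c; d] by rewrite -E !inE eqxx orbT.
have: c \in [fset a; b] by rewrite E !inE eqxx.
have: d \in [fset a; b] by rewrite E !inE eqxx orbT.
rewrite !inE.
by do 4![case/orP=> /eqP ?]; subst; auto.
Qed.

(** * Growing trees in an arbitrary graph *)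

Section Graphs.
Variable T : choiceType.
Implicit Types (g : rel T) (V : {fset T}) (E : {fset {fset T}}).

Lemma edge_rel_adj g V E :
  symmetric g -> is_subgraph g V E -> subrel (edge_rel E) g.
Proof.
move=> gC sgE a b /sgE [u [v [_ _ guv /fset2_inj]]].
by case=> -[-> ->] //; rewrite gC.
Qed.

Lemma edge_rel_mem g V E a b :
  is_subgraph g V E -> edge_rel E a b -> (a \in V) && (b \in V).
Proof.
by move=> sgE /sgE [u [v [uV vV _ /fset2_inj]]]; case=> -[-> ->]; apply/andP.
Qed.

Lemma edge_relC E : symmetric (edge_rel E).
Proof. by move=> a b; rewrite /edge_rel fsetUC. Qed.

(** The only neighbour of [w] in the enlarged graph is [u], so a cycle through [w] would visit [u]
    twice, and a cycle avoiding [w] would already lie in [E]. *)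
Lemma tree_add_leaf g V E u w :
  is_tree_in g V E -> u \in V -> w \notin V -> g u w ->
  is_tree_in g (w |` V) ([fset u; w] |` E).
Proof.
move=> [_ sgE cE aE] uV wV guw; set E' := [fset u; w] |` E.
have sub : subrel (edge_rel E) (edge_rel E').
  by move=> a b; rewrite /edge_rel /E' in_fset1U => ->; rewrite orbT.
have uw : edge_rel E' u w by rewrite /edge_rel /E' in_fset1U eqxx.
have wu : edge_rel E' w u by rewrite edge_relC.
have leaf b : edge_rel E' w b -> b = u.
  rewrite /edge_rel in_fset1U => /orP[/eqP/fset2_inj[[wu' _]|[_ //]]|].
    by rewrite wu' uV in wV.
  by move/(edge_rel_mem sgE)/andP => [wV']; rewrite wV' in wV.
split.
- by apply/fset0Pn; exists w; rewrite fset1U1.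
- move=> e /fset1UP[->|/sgE [a [b [aV bV gab ->]]]].
    by exists u, w; rewrite fset1U1 fset1Ur.
  by exists a, b; rewrite !fset1Ur.
- have cV a b : a \in V -> b \in V ->
      exists p, path (edge_rel E') a p /\ last a p = b.
    move=> aV bV; have [p [pp lp]] := cE a b aV bV.
    by exists p; split=> //; apply: sub_path pp.
  move=> a b /fset1UP[->|aV] /fset1UP[->|bV].
  + by exists [::].
  + have [p [pp lp]] := cV u b uV bV.
    by exists (u :: p); rewrite /= wu.
  + have [p [pp lp]] := cV a u aV uV.
    by exists (rcons p w); rewrite rcons_path last_rcons pp lp uw.
  + exact: cV.
- move=> c c3 uc; apply/negP => cyc.
  have [wc|wc] := boolP (w \in c).
    have [i c' rc] := rot_to wc.
    (* With the cycle rotated to start at [w], its second and last vertices are both neighbours of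
       [w], hence both [u], against [uniq]. *)
    move: cyc uc c3; rewrite -(rot_cycle i) -(rot_uniq i) -(size_rot i) rc.
    case: c' {rc} => [|a c'] //=; case/lastP: c' => [|c' z] //=.
    rewrite rcons_path last_rcons => /andP[/leaf -> /andP[_ zw]].
    move: zw; rewrite edge_relC => /leaf ->.
    by case/and3P=> _; rewrite mem_rcons mem_head.
  move/negP: (aE c c3 uc); apply.
  apply: (sub_in_cycle (P := mem c)) cyc; last exact/allP.
  move=> a b ac bc; rewrite /edge_rel in_fset1U => /orP[/eqP/fset2_inj|//].
  by case=> -[ea eb]; case/negP: wc; [rewrite -eb | rewrite -ea].
Qed.

(** An edge whose endpoint already lies in the tree is skipped and the walk resumes from there.
    Hence [p] may meet the tree or itself, and the count is only an inequality. *)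
Lemma tree_add_path g V E u p :
  is_tree_in g V E -> u \in V -> path g u p ->
  exists V' E', [/\ is_tree_in g V' E', V `<=` V', last u p \in V' &
    (#|` E'| <= #|` E| + size p)%N].
Proof.
elim: p u V E => [|w p IHp] u V E tE uV /=.
  by exists V, E; rewrite addn0.
case/andP=> guw pp; have [wV|wV] := boolP (w \in V).
  have [V' [E' [t sV lV sE]]] := IHp w V E tE wV pp.
  exists V', E'; split=> //; apply: leq_trans sE _.
  by rewrite addnS.
have [|V' [E' [t sV lV sE]]] := IHp w _ _ (tree_add_leaf tE uV wV guw) _ pp.
  by rewrite fset1U1.
exists V', E'; split=> //.
  exact: fsubset_trans (fsubsetU1 _ _) sV.
apply: leq_trans sE _; rewrite addnS -addSn leq_add2r.
by rewrite cardfsU1; case: (_ \notin _); rewrite ?add1n ?add0n.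
Qed.

(** * Edges of a path, and tripods in a connected graph *)

Fixpoint path_edges (x : T) (p : seq T) : seq {fset T} :=
  if p is y :: p' then [fset x; y] :: path_edges y p' else [::].

Lemma size_path_edges x p : size (path_edges x p) = size p.
Proof. by elim: p x => //= y p IHp x; rewrite IHp. Qed.

Lemma path_edgesP E x p :
  path (edge_rel E) x p -> {subset path_edges x p <= E}.
Proof.
elim: p x => //= y p IHp x /andP[xy /IHp sub] e.
by rewrite inE => /orP[/eqP ->|/sub].
Qed.

Lemma mem_path_edge x p e z :
  e \in path_edges x p -> z \in e -> z \in x :: p.
Proof.
elim: p x => //= y p IHp x; rewrite inE => /orP[/eqP ->|ep ze].
  by rewrite !inE => /orP[] ->; rewrite ?orbT.
by rewrite inE (IHp y) ?orbT.
Qed.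

(** Separates a branch from the path it leaves: the branch starts on that path, but its later
    vertices avoid it, so no edge is shared. *)
Lemma path_edge_tail x p e :
  e \in path_edges x p -> exists2 z, z \in e & z \in p.
Proof.
elim: p x => //= y p IHp x; rewrite inE => /orP[/eqP ->|/IHp [z ze zp]].
  by exists y; rewrite !inE eqxx ?orbT.
by exists z; rewrite // inE zp orbT.
Qed.

Lemma uniq_path_edges x p : uniq (x :: p) -> uniq (path_edges x p).
Proof.
elim: p x => //= y p IHp x /andP[xp up]; rewrite IHp // andbT.
apply: contra xp => /mem_path_edge; apply.
by rewrite !inE eqxx.
Qed.

(** [c] is the last vertex of the walk in [P]. Appending a vertex of [P] resets the remainder to the
    empty walk. *)
Lemma path_last_exit (e : rel T) (P : {pred T}) u p :
  u \in P -> path e u p ->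
  exists c q, [/\ c \in P, path e c q, last c q = last u p &
                  {in q, forall z, z \notin P}].
Proof.
move=> uP; elim/last_ind: p => [|p w IHp]; first by exists u, [::].
rewrite rcons_path last_rcons => /andP[/IHp [c [q [cP pq lq qP]]] ew].
have [wP|wP] := boolP (w \in P); first by exists w, [::].
exists c, (rcons q w); rewrite rcons_path last_rcons lq pq ew; split=> //.
by move=> z; rewrite mem_rcons inE => /orP[/eqP ->|/qP].
Qed.

(** Take a simple path from [v1] to [v2] and a walk from [v1] to [v3]; the centre [c] is the last
    vertex of the walk on the path. It cuts the path into two legs, and the rest of the walk is the
    third. *)
Lemma connected_tripod g V E v1 v2 v3 :
  symmetric g -> is_subgraph g V E -> connected_graph V E ->
  v1 \in V -> v2 \in V -> v3 \in V ->
  exists c p1 p2 p3,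
    [/\ path g c p1 /\ last c p1 = v1, path g c p2 /\ last c p2 = v2,
        path g c p3 /\ last c p3 = v3 &
        (size p1 + size p2 + size p3 <= #|` E|)%N].
Proof.
move=> gC sgE cE v1V v2V v3V; have subg := edge_rel_adj gC sgE.
have [p0 [/shortenP[p pp up _] lp]] := cE _ _ v1V v2V.
have [q0 [pq0 lq0]] := cE _ _ v1V v3V.
have [c [q1 [cp pq1 lq1 q1p]]] :=
  path_last_exit (P := mem (v1 :: p)) (mem_head _ _) pq0.
(* Shortening makes the edges of the third leg distinct, and keeps its vertices among those of [q1],
   off the first path. *)
case/shortenP: pq1 lq1 => q pq uq sq lq.
have disj : {in q, forall z, z \notin v1 :: p} by move=> z /sq /q1p.
have size_le : (size p + size q <= #|` E|)%N.
  rewrite -(size_path_edges v1 p) -(size_path_edges c q) -size_cat.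
  apply: uniq_leq_size => [|e]; last first.
    by rewrite mem_cat => /orP[]; apply: path_edgesP.
  rewrite cat_uniq !uniq_path_edges // andbT /=.
  apply/hasPn => e /path_edge_tail [z ze /disj]; apply: contra => ep.
  exact: mem_path_edge ep ze.
case/splitPl: p / cp pp lp up size_le {q1p disj} => pa pb lpa.
rewrite cat_path last_cat size_cat lpa => /andP[ppa ppb] lpb _ size_le.
(* [pa] runs from [v1] to [c]; [belast] drops the final [c], which becomes the starting point of the
   reversed leg. *)
exists c, (rev (belast v1 pa)), pb, q; split.
- have := rev_path g v1 pa.
  rewrite lpa => rp; split.
    by rewrite rp; apply: sub_path ppa => a b /subg; rewrite gC.
  by case: pa {rp ppa size_le} lpa => [|a pa] //=; rewrite rev_cons last_rcons.
- by split=> //; apply: sub_path ppb.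
- by split; [apply: sub_path pq | rewrite lq].
- by rewrite size_rev size_belast.
Qed.

End Graphs.

(** * The distance of the hexagonal graph *)

(** With [dx], [dy] the coordinate differences, this is the spread of the set of [dx], [dy] and 0,
    that is, the maximum of |dx|, |dy| and |dx - dy|. *)
Definition hexdist (p q : hexpoint) : int :=
  Num.max (Num.max (p.1 - q.1) (p.2 - q.2)) 0
  - Num.min (Num.min (p.1 - q.1) (p.2 - q.2)) 0.

Lemma hexdistC p q : hexdist p q = hexdist q p.
Proof. rewrite /hexdist; lia. Qed.

Lemma hexdist_ge0 p q : 0 <= hexdist p q.
Proof. rewrite /hexdist; lia. Qed.

Lemma hexdist_triangle p q r : hexdist p r <= hexdist p q + hexdist q r.
Proof. rewrite /hexdist; lia. Qed.

(** The squared modulus of a + b omega is a^2 - ab + b^2. Both this form and [hexdist] take the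
    value 1 exactly at the six unit steps. *)
Lemma hex_adjE (R : realType) (p q : hexpoint) :
  hex_adj R p q = (hexdist p q == 1).
Proof.
have sqnorm (a b : int) :
    (a%:~R - b%:~R / 2 : R) ^+ 2 + (Num.sqrt 3 / 2 * b%:~R) ^+ 2
    = (a ^+ 2 - a * b + b ^+ 2)%:~R.
  rewrite exprMn expr_div_n sqr_sqrtr // intrD intrB intrM !rmorphXn /=.
  by field.
case: p q => [x y] [x' y'].
rewrite /hex_adj /hex_embed /omega /=.
set a : int := x - x'; set b : int := y - y'.
have -> : x%:~R + Complex (- (1 / 2)) (Num.sqrt 3 / 2) * y%:~R
    - (x'%:~R + Complex (- (1 / 2)) (Num.sqrt 3 / 2) * y'%:~R)
  = Complex (a%:~R - b%:~R / 2 : R) (Num.sqrt 3 / 2 * b%:~R).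
  have intC (n : int) : n%:~R = Complex (n%:~R : R) 0.
    by rewrite -[LHS](rmorph_int (real_complex R)).
  rewrite !intC /a /b; simpc.
  by rewrite !rmorphB /=; congr Complex; ring.
rewrite normc_def eq_complex /= eqxx andbT sqnorm.
have -> : (Num.sqrt ((a ^+ 2 - a * b + b ^+ 2)%:~R : R) == 1)
   = (a ^+ 2 - a * b + b ^+ 2 == 1).
  have n0 : 0 <= a ^+ 2 - a * b + b ^+ 2 by nia.
  by rewrite -(@eqr_int R) -[X in (_ == X) = _]sqrtr1 eqr_sqrt ?ler01 ?ler0z.
rewrite /hexdist /= -/a -/b; move: a b => a b.
have trit (z : int) : -1 <= z <= 1 -> z = -1 \/ z = 0 \/ z = 1 by lia.
(* Either equation confines [a] and [b] to -1, 0, 1, leaving nine pairs to check. *)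
apply/eqP/eqP => h.
  have /trit ha : -1 <= a <= 1 by nia.
  have /trit hb : -1 <= b <= 1 by nia.
  by case: ha h => [|[]] ->; case: hb => [|[]] ->; lia.
have /trit ha : -1 <= a <= 1 by lia.
have /trit hb : -1 <= b <= 1 by lia.
by case: ha h => [|[]] ->; case: hb => [|[]] ->; lia.
Qed.

(** * Optimality of the coordinatewise median *)

Lemma mid3E (a b c : int) :
  mid3 a b c = Num.max (Num.min a b) (Num.min (Num.max a b) c).
Proof.
by rewrite /mid3 /sort /=; do ![case: ifP => /= ?]; lia.
Qed.

Lemma mid3_cases (a b c : int) :
  [\/ mid3 a b c = a /\ (b <= a <= c \/ c <= a <= b),
      mid3 a b c = b /\ (a <= b <= c \/ c <= b <= a) |
      mid3 a b c = c /\ (a <= c <= b \/ b <= c <= a)].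
Proof.
rewrite mid3E.
have [|[|]] : (b <= a <= c \/ c <= a <= b) \/ (a <= b <= c \/ c <= b <= a)
    \/ (a <= c <= b \/ b <= c <= a) by lia.
- move=> h; constructor 1; lia.
- move=> h; constructor 2; lia.
- move=> h; constructor 3; lia.
Qed.

Lemma hexdist_bounds p q
    (d := hexdist p q) (dx := p.1 - q.1) (dy := p.2 - q.2) :
  [/\ -d <= dx <= d, -d <= dy <= d & -d <= dx - dy <= d].
Proof. by rewrite /d /hexdist /dx /dy; split; lia. Qed.

(** Once the orders and maxima are fixed, the left side is linear and is reached by adding bounds
    from [hexdist_bounds] in which [c] = (x, y) cancels. For instance x2 - x1 + y3 - y2 is the sum
    of x - x1, (x2 - x) - (y2 - y) and y3 - y. *)
Lemma hexdist_sum_min (v1 v2 v3 c : hexpoint) :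
  let m := (mid3 v1.1 v2.1 v3.1, mid3 v1.2 v2.2 v3.2) in
  hexdist v1 m + hexdist v2 m + hexdist v3 m
  <= hexdist v1 c + hexdist v2 c + hexdist v3 c.
Proof.
have := (hexdist_bounds v1 c, hexdist_bounds v2 c, hexdist_bounds v3 c).
(* The distances to [c] become unknowns constrained only by their linear bounds. *)
move: (hexdist v1 c) (hexdist v2 c) (hexdist v3 c) => d1 d2 d3.
case: v1 v2 v3 c => [x1 y1] [x2 y2] [x3 y3] [x y] /=.
case=> -[[? ? ?] [? ? ?]] [? ? ?].
by case: (mid3_cases x1 x2 x3) => -[-> [] ?];
  case: (mid3_cases y1 y2 y3) => -[-> [] ?]; rewrite /hexdist /=; lia.
Qed.

(** * Walks and geodesics *)

Lemma hexdist_path (R : realType) p s :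
  path (hex_adj R) p s -> hexdist p (last p s) <= (size s)%:Z.
Proof.
elim: s p => [|q s IHs] p /=; first by rewrite /hexdist; lia.
rewrite hex_adjE => /andP[/eqP pq /IHs].
have := hexdist_triangle p q (last q s); lia.
Qed.

Lemma hexdist_eq0 p q : hexdist p q = 0 -> p = q.
Proof.
by case: p q => [x y] [x' y']; rewrite /hexdist /= => h; congr pair; lia.
Qed.

(** Step diagonally when both coordinates must move in the same direction. Otherwise the distance is
    |dx| + |dy|, and moving one coordinate towards [q] gains 1. *)
Lemma hexdist_step p q : p != q ->
  exists2 r, hexdist p r = 1 & hexdist p q = hexdist r q + 1.
Proof.
case: p q => [x y] [x' y']; rewrite xpair_eqE /hexdist /= => neq.
have [h|h] := boolP ((x < x') && (y < y')).
  by exists (x + 1, y + 1) => /=; lia.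
have [h'|h'] := boolP ((x' < x) && (y' < y)).
  by exists (x - 1, y - 1) => /=; lia.
have [xx|xx] := boolP (x < x'); first by exists (x + 1, y) => /=; lia.
have [xx'|xx'] := boolP (x' < x); first by exists (x - 1, y) => /=; lia.
have [yy|yy] := boolP (y < y'); first by exists (x, y + 1) => /=; lia.
by exists (x, y - 1) => /=; lia.
Qed.

Lemma hexdist_geodesic (R : realType) p q :
  exists s, [/\ path (hex_adj R) p s, last p s = q &
                (size s)%:Z = hexdist p q].
Proof.
have [n] : exists n : nat, hexdist p q = n%:Z.
  by exists `|hexdist p q|%N; have := hexdist_ge0 p q; lia.
elim: n p => [|n IHn] p hn.
  by exists [::]; rewrite hn (hexdist_eq0 hn).
have [pq|/hexdist_step [r pr prq]] := eqVneq p q.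
  by move: hn; rewrite pq /hexdist; lia.
have [|s [ps ls ss]] := IHn r; first by lia.
by exists (r :: s); split=> /=; rewrite ?hex_adjE ?pr ?eqxx //; lia.
Qed.

Lemma hex_adj_sym (R : realType) : symmetric (hex_adj R).
Proof. by move=> p q; rewrite !hex_adjE hexdistC. Qed.

(** * The two bounds on the tristance *)

Lemma tree_add_hexpoint (R : realType) V E p q :
  is_tree_in (hex_adj R) V E -> p \in V ->
  exists V' E', [/\ is_tree_in (hex_adj R) V' E', V `<=` V', q \in V' &
    #|` E'|%:Z <= #|` E|%:Z + hexdist q p].
Proof.
move=> tE pV; have [s [ps ls ss]] := hexdist_geodesic R p q.
have [V' [E' [tE' sV lV sE]]] := tree_add_path tE pV ps.
by exists V', E'; split=> //; [rewrite -ls | rewrite hexdistC -ss].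
Qed.

Lemma hex_tree_star (R : realType) m v1 v2 v3 :
  exists V E, tree_spanning (hex_adj R) [:: v1; v2; v3] V E /\
    #|` E|%:Z <= hexdist v1 m + hexdist v2 m + hexdist v3 m.
Proof.
have t0 : is_tree_in (hex_adj R) [fset m] fset0.
  split.
  - by apply/fset0Pn; exists m; rewrite inE.
  - by move=> e; rewrite inE.
  - by move=> a b; rewrite !inE => /eqP -> /eqP ->; exists [::].
  (* A cycle on more than two vertices has a first edge, which the empty edge set excludes. *)
  - by case=> [|a [|b c]] //= _ _; rewrite /edge_rel inE.
have [|V1 [E1 [t1 s1 m1 c1]]] := tree_add_hexpoint (p := m) v1 t0.
  by rewrite inE.
have mV1 : m \in V1 by apply: (fsubsetP s1); rewrite inE.
have [V2 [E2 [t2 s2 m2 c2]]] := tree_add_hexpoint v2 t1 mV1.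
have mV2 : m \in V2 by apply: (fsubsetP s2).
have [V3 [E3 [t3 s3 m3 c3]]] := tree_add_hexpoint v3 t2 mV2.
exists V3, E3; split; last by move: c1; rewrite cardfs0; lia.
split=> // v; rewrite !inE => /or3P[] /eqP -> //; last exact: (fsubsetP s3).
by apply: (fsubsetP s3); apply: (fsubsetP s2).
Qed.

Lemma hex_tree_lower_bound (R : realType) v1 v2 v3 V E :
  tree_spanning (hex_adj R) [:: v1; v2; v3] V E ->
  exists c, hexdist v1 c + hexdist v2 c + hexdist v3 c <= #|` E|%:Z.
Proof.
case=> -[_ sgE cE _] sV.
have [||| c [p1 [p2 [p3 [[P1 L1] [P2 L2] [P3 L3] sz]]]]] :=
  connected_tripod (v1 := v1) (v2 := v2) (v3 := v3) (hex_adj_sym R) sgE cE;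
  try by apply: sV; rewrite !inE eqxx ?orbT.
exists c; move: sz; rewrite -lez_nat !PoszD; apply: le_trans.
move: (hexdist_path P1) (hexdist_path P2) (hexdist_path P3).
rewrite L1 L2 L3 !(hexdistC c) => h1 h2 h3.
by rewrite !lerD.
Qed.

Theorem theorem22 (R : realType) (v1 v2 v3 : hexpoint)
    (h12 : v1 <> v2) (h13 : v1 <> v3) (h23 : v2 <> v3) :
  let xmid := mid3 v1.1 v2.1 v3.1 in
  let ymid := mid3 v1.2 v2.2 v3.2 in
  exists2 n : nat, is_tristance R v1 v2 v3 n &
    n%:Z = \sum_(v <- [:: v1; v2; v3])
      (Num.max (Num.max (v.1 - xmid) (v.2 - ymid)) 0
       - Num.min (Num.min (v.1 - xmid) (v.2 - ymid)) 0).
Proof.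
move=> xmid ymid; set m : hexpoint := (xmid, ymid).
have [V [E [tE sE]]] := hex_tree_star R m v1 v2 v3.
have lb V' E' : tree_spanning (hex_adj R) [:: v1; v2; v3] V' E' ->
    hexdist v1 m + hexdist v2 m + hexdist v3 m <= #|` E'|%:Z.
  by case/hex_tree_lower_bound=> c; apply: le_trans; apply: hexdist_sum_min.
(* The star is itself a spanning tree, so the lower bound applies to it and its edge count is
   exactly the sum; this count serves as the natural number [n]. *)
have nE : #|` E|%:Z = hexdist v1 m + hexdist v2 m + hexdist v3 m.
  by apply: le_anti; apply/andP; split; last exact: lb tE.
exists #|` E|; last by rewrite nE -addrA !big_cons big_nil addr0.
split; first by exists V, E.
by move=> V' E' /lb; rewrite -nE lez_nat.
Qed.
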